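(* Consider a stationary imprecise Markov chain with finite state set $\mathcal{X}$ and upper transition operator $\overline{T}$. If the associated set of transition matrices $\mathcal{T}_{\overline{T}}$ is product scrambling, then the chain is regularly absorbing.
   Context: $\mathcal{X}$ is a finite non-empty set and $\mathcal{L}(\mathcal{X})$ is the set of real-valued maps on $\mathcal{X}$; $I_A$ is the indicator of $A\subseteq\mathcal{X}$; $\mathbb{N}=\{1,2,\dots\}$. A credal set is a non-empty closed convex set of probability mass functions on $\mathcal{X}$. A stationary imprecise Markov chain (with infinite time horizon) has for each state $x\in\mathcal{X}$ a credal set $\mathcal{Q}(\cdot\mid x)$ of transition mass functions, the same at all times. Its upper transition operator $\overline{T}:\mathcal{L}(\mathcal{X})\to\mathcal{L}(\mathcal{X})$ is $\overline{T}h(x)=\max\{\sum_z h(z)q(z):q\in\mathcal{Q}(\cdot\mid x)\}$, and its lower transition operator is $\underline{T}h=-\overline{T}(-h)$. Powers of operators denote iterated composition. Let $\mathcal{R}=\{x\in\mathcal{X}:(\exists n\in\mathbb{N})(\forall k\ge n)(\forall y\in\mathcal{X})\ \overline{T}^{\,k}I_{\{x\}}(y)>0\}$. The chain is regularly absorbing if $\mathcal{R}\neq\emptyset$ and for every $y\in\mathcal{X}\setminus\mathcal{R}$ there is some $n\in\mathbb{N}$ such that $\underline{T}^{\,n}I_{\mathcal{R}}(y)>0$. A transition matrix is a matrix $T\in\mathbb{R}^{\mathcal{X}\times\mathcal{X}}$ with $T_{xy}\ge0$ and $\sum_{z}T_{xz}=1$. Let $\mathcal{Q}_{\overline{T}}(\cdot\mid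 x)$ be the set of probability mass functions $q$ on $\mathcal{X}$ with $\sum_z h(z)q(z)\le\overline{T}h(x)$ for all $h\in\mathcal{L}(\mathcal{X})$. Then $\mathcal{T}_{\overline{T}}$ is the set of all matrices $T\in\mathbb{R}^{\mathcal{X}\times\mathcal{X}}$ such that for each $x\in\mathcal{X}$ the row $T_{x\cdot}$ belongs to $\mathcal{Q}_{\overline{T}}(\cdot\mid x)$ (rows chosen independently). For a set $\mathcal{T}$ of transition matrices, $\mathcal{T}^m=\{T_1T_2\cdots T_m:T_1,\dots,T_m\in\mathcal{T}\}$. The coefficient of ergodicity of a transition matrix $T$ is $\tau(T)=\frac12\max_{x,y\in\mathcal{X}}\sum_{z\in\mathcal{X}}|T_{xz}-T_{yz}|=1-\min_{x,y\in\mathcal{X}}\sum_{z\in\mathcal{X}}\min\{T_{xz},T_{yz}\}$. $\mathcal{T}$ is product scrambling if there is some $m\in\mathbb{N}$ such that $\tau(T)<1$ for all $T\in\mathcal{T}^m$. *)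

(* Defs.v *)
From HB Require Import structures.
From mathcomp Require Import all_boot all_order all_algebra.
From mathcomp Require Import all_classical all_reals all_analysis.

Set Implicit Arguments.
Unset Strict Implicit.
Unset Printing Implicit Defensive.

Import Order.TTheory GRing.Theory Num.Theory.
Import numFieldNormedType.Exports.

Local Open Scope classical_set_scope.
Local Open Scope ring_scope.

Section ImpreciseMarkovChain.
Context {R : realType} {X : finType}.

Definition pmf : set (X -> R) :=
  [set q | (forall x, 0 <= q x) /\ \sum_x q x = 1].

(* [X] being finite, the product topology of [{ptws X -> R}] is the usual
   topology of the finite-dimensional space [X -> R]; [R^o] provides the
   vector space structure with respect to which convexity is understood. *)
Definition credal_set (C : set (X -> R)) : Prop :=
  [/\ C `<=` pmf, C !=set0, closed (C : set {ptws X -> R}) &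
      convex_set (C : set (convex_lmodType (X -> R^o)))].

Definition expectation_values (C : set (X -> R)) (h : X -> R) : set R :=
  [set \sum_z h z * q z | q in C].

(* When the [Q x] are credal sets this supremum is a maximum: see
   [upper_trans_max]. *)
Definition upper_trans (Q : X -> set (X -> R)) (h : X -> R) : X -> R :=
  fun x => sup (expectation_values (Q x) h).

(* The remaining notions only depend on the chain through its upper transition
   operator. *)
Definition lower_of (Tup : (X -> R) -> (X -> R)) (h : X -> R) : X -> R :=
  fun x => - Tup (fun y => - h y) x.

Definition regular_states (Tup : (X -> R) -> (X -> R)) : set X :=
  [set x | exists n : nat, (0 < n)%N /\
     forall k : nat, (n <= k)%N -> forall y, 0 < iter k Tup \1_[set x] y].

Definition regularly_absorbing (Tup : (X -> R) -> (X -> R)) : Prop :=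
  regular_states Tup !=set0 /\
  forall y, ~ regular_states Tup y ->
    exists n : nat, (0 < n)%N /\
      0 < iter n (lower_of Tup) \1_(regular_states Tup) y.

(* Matrices indexed by [X] are [#|X|]-by-[#|X|] matrices, through the
   enumeration of [X]. *)
Definition entry (T : 'M[R]_#|X|) (x y : X) : R :=
  T (enum_rank x) (enum_rank y).

Definition transition_matrix (T : 'M[R]_#|X|) : Prop :=
  (forall x y, 0 <= entry T x y) /\ (forall x, \sum_z entry T x z = 1).

Definition dominated_pmf (Tup : (X -> R) -> (X -> R)) (x : X) : set (X -> R) :=
  [set q | pmf q /\ forall h : X -> R, \sum_z h z * q z <= Tup h x].

Definition transition_matrices (Tup : (X -> R) -> (X -> R)) :
    set 'M[R]_#|X| :=
  [set T | forall x, dominated_pmf Tup x (entry T x)].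

Definition product_set (TT : set 'M[R]_#|X|) (m : nat) : set 'M[R]_#|X| :=
  [set T | exists F : 'I_m -> 'M[R]_#|X|,
     (forall i, TT (F i)) /\ T = \prod_(i < m) F i].

(* The maximised quantities are nonnegative, so that the default value [0]
   of the iterated maxima is harmless. *)
Definition ergodicity_coef (T : 'M[R]_#|X|) : R :=
  2^-1 * \big[Num.max/0]_(x : X) \big[Num.max/0]_(y : X)
           \sum_z `|entry T x z - entry T y z|.

Definition product_scrambling (TT : set 'M[R]_#|X|) : Prop :=
  exists m : nat, (0 < m)%N /\
    forall T, product_set TT m T -> ergodicity_coef T < 1.

Lemma transition_matrices_sub (Tup : (X -> R) -> (X -> R)) :
  transition_matrices Tup `<=` transition_matrix.
Proof.
by move=> T HT; split=> [x y|x]; have [[q0 q1] _] := HT x.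
Qed.

Lemma compact_credal_set (C : set (X -> R)) :
  credal_set C -> compact (C : set {ptws X -> R}).
Proof.
case=> Cpmf _ Ccl _.
apply: (@subclosed_compact {ptws X -> R} _
  [set q : {ptws X -> R} | forall x, `[0, 1]%classic (q x)]) => //.
  by apply: (@tychonoff X (fun=> R) (fun=> `[0, 1]%classic)) => x;
    exact: segment_compact.
move=> q /Cpmf [q0 q1] x; rewrite /= in_itv /= q0 /=.
by rewrite -q1 (bigD1 x) //= lerDl sumr_ge0.
Qed.

Lemma upper_trans_max (Q : X -> set (X -> R)) (h : X -> R) (x : X) :
  credal_set (Q x) ->
  expectation_values (Q x) h (upper_trans Q h x) /\
  ubound (expectation_values (Q x) h) (upper_trans Q h x).
Proof.
move=> QC; have Ccpt := compact_credal_set QC; case: QC => _ [q0 Qq0] _ _.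
have Ecpt : compact (expectation_values (Q x) h).
  apply: (@continuous_compact {ptws X -> R} R
    (fun q : {ptws X -> R} => \sum_z h z * q z)) => //.
  apply: continuous_subspaceT; apply: (@continuous_big R) => [|z _].
    exact: (@add_continuous R).
  move=> q; apply: (@continuousM R {ptws X -> R} (fun=> h z)).
    exact: cst_continuous.
  exact: (@proj_continuous X (fun=> R) z).
have E0 : expectation_values (Q x) h !=set0.
  by exists (\sum_z h z * q0 z), q0.
have Eb : has_sup (expectation_values (Q x) h).
  split => //; have [M [_ HM]] := compact_bounded Ecpt.
  exists (M + 1) => e Ee; apply: le_trans (ler_norm _) _.
  by apply: HM => //; rewrite ltrDl.
split; last exact: sup_upper_bound.
apply: (compact_closed (@Rhausdorff R) Ecpt).
exact: closure_sup E0 Eb.2.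
Qed.

End ImpreciseMarkovChain.

(* Main.v *)
Require Import Defs.
From mathcomp Require Import all_boot all_order all_algebra.
From mathcomp Require Import all_classical all_reals all_analysis.

(** The argument tests the scrambling hypothesis only on products [T ^+ m] whose
    factors are all equal, and rests on two observations.

    Existence of a regular state: take any [T] in the set of matrices.  Any two
    rows of [T ^+ m] have a common positive column, so by merging states one at
    a time some power of [T] has an everywhere positive column [z]
    ([positive_column]).  That column stays positive in all higher powers, and
    the iterates of the upper operator dominate the powers of [T]
    ([iter_upper_trans_ge]); hence [z] is regular.

    Absorption: the set of regular states is closed, in that no mass function
    of the chain leaves it ([regular_states_closed]).  Consequently the iterates
    of the lower operator on its indicator increase.  Let [B] be the set of
    states where all of them vanish.  As there are finitely many states, one
    iterate is positive everywhere off [B]; the next one vanishes on [B], so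
    every state of [B] has a mass function carried by [B].  With such rows on
    [B] and arbitrary ones elsewhere, one gets a matrix for which both [B] and
    the set of regular states are closed.  All its powers keep the two disjoint
    sets separated, so none of them is scrambling unless [B] is empty. *)

Set Implicit Arguments.
Unset Strict Implicit.
Unset Printing Implicit Defensive.

Import Order.TTheory GRing.Theory Num.Theory.

Local Open Scope classical_set_scope.
Local Open Scope ring_scope.

(** * Transition matrices *)

Section TransitionMatrices.
Context {R : realType} {X : finType}.
Implicit Types (S T : 'M[R]_#|X|) (A B : set X).

Lemma entry_mul S T (x y : X) :
  entry (S * T) x y = \sum_z entry S x z * entry T z y.
Proof.
rewrite /entry mxE (reindex (@enum_rank X)) //.
exact/onW_bij/enum_rank_bij.
Qed.

Lemma entry1 (x y : X) : entry (1 : 'M[R]_#|X|) x y = (x == y)%:R.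
Proof. by rewrite /entry mxE (inj_eq enum_rank_inj). Qed.

Lemma transition_matrix1 : transition_matrix (1 : 'M[R]_#|X|).
Proof.
split=> [x y|x]; first by rewrite entry1 ler0n.
rewrite (bigD1 x) //= entry1 eqxx big1 ?addr0 // => z zx.
by rewrite entry1 eq_sym (negbTE zx).
Qed.

Lemma transition_matrixM S T :
  transition_matrix S -> transition_matrix T -> transition_matrix (S * T).
Proof.
move=> [S0 S1] [T0 T1]; split=> [x y|x].
  by rewrite entry_mul sumr_ge0 // => z _; rewrite mulr_ge0.
under eq_bigr => z _ do rewrite entry_mul.
rewrite exchange_big /= -(S1 x); apply: eq_bigr => z _.
by rewrite -mulr_sumr T1 mulr1.
Qed.

Lemma transition_matrixX T k :
  transition_matrix T -> transition_matrix (T ^+ k).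
Proof.
move=> HT; elim: k => [|k IH]; first exact: transition_matrix1.
by rewrite exprS; apply: transition_matrixM.
Qed.

Lemma pmf_gt0 (q : X -> R) : Defs.pmf q -> exists z, 0 < q z.
Proof.
move=> [q0 q1]; apply: contrapT => /forallNP q_le0.
have : \sum_x q x = 0.
  by apply: big1 => x _; apply/eqP; rewrite eq_le q0 leNgt andbT; apply/negP.
by rewrite q1 => /eqP; rewrite oner_eq0.
Qed.

Lemma indic_set1 (x y : X) : \1_[set x] y = (y == x)%:R :> R.
Proof.
by rewrite indicE; congr (nat_of_bool _)%:R; apply/idP/eqP; rewrite inE.
Qed.

Lemma entry_gt0 T (x : X) : transition_matrix T -> exists z, 0 < entry T x z.
Proof. by move=> [T0 T1]; apply: pmf_gt0. Qed.

Lemma entry_mul_gt0 S T (x z y : X) :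
  transition_matrix S -> transition_matrix T ->
  0 < entry S x z -> 0 < entry T z y -> 0 < entry (S * T) x y.
Proof.
move=> [S0 _] [T0 _] Sxz Tzy.
rewrite entry_mul (bigD1 z) //= ltr_pwDl ?mulr_gt0 // sumr_ge0 // => w _.
exact: mulr_ge0.
Qed.

Lemma entry_mul_gt0E S T (x y : X) :
  transition_matrix S -> transition_matrix T -> 0 < entry (S * T) x y ->
  exists2 z, 0 < entry S x z & 0 < entry T z y.
Proof.
move=> [S0 _] [T0 _] STxy; apply: contrapT => noz.
suff ST0 : entry (S * T) x y = 0 by move: STxy; rewrite ST0 ltxx.
rewrite entry_mul big1 // => z _; apply/eqP; rewrite mulf_eq0.
apply: contrapT => /negP; rewrite negb_or => /andP[Sn0 Tn0].
by apply: noz; exists z; rewrite lt_def ?Sn0 ?Tn0 /=.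
Qed.

(** A transition matrix with coefficient of ergodicity below 1 is scrambling:
    rows with disjoint supports are at [l1]-distance 2. *)
Lemma ergodicity_coef_lt1 T (x y : X) :
  transition_matrix T -> ergodicity_coef T < 1 ->
  exists z, 0 < entry T x z /\ 0 < entry T y z.
Proof.
move=> [T0 T1]; apply: contraPP => /forallNP disj; apply/negP; rewrite -leNgt.
have dist2 : \sum_z `|entry T x z - entry T y z| = 2.
  transitivity (\sum_z (entry T x z + entry T y z)).
    apply: eq_bigr => z _.
    have [Tx|Tx] := ltP 0 (entry T x z).
      have [Ty|Ty] := ltP 0 (entry T y z); first by case: (disj z).
      have -> : entry T y z = 0 by apply/eqP; rewrite eq_le Ty T0.
      by rewrite subr0 addr0 ger0_norm.
    have -> : entry T x z = 0 by apply/eqP; rewrite eq_le Tx T0.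
    by rewrite sub0r add0r normrN ger0_norm.
  by rewrite big_split /= !T1.
rewrite /ergodicity_coef mulrC ler_pdivlMr // mul1r.
apply: le_trans (le_bigmax _ _ x); apply: le_trans (le_bigmax _ _ y).
by rewrite dist2.
Qed.

(** A finite family of states is merged into one by adding states one by one:
    when [y] for all [y \in s] can reach [z], and [a] can reach [a'], all can
    reach a common successor of [z] and [a']. *)
Lemma common_successor T (s : seq X) : (0 < #|X|)%N ->
  transition_matrix T ->
  (forall x y, exists z, 0 < entry T x z /\ 0 < entry T y z) ->
  exists k z, forall y, y \in s -> 0 < entry (T ^+ k) y z.
Proof.
move=> /card_gt0P[x0 _] HT scr; elim: s => [|a s [k [z kz]]].
  by exists 0%N, x0.
have HTk := transition_matrixX k HT.
have [a' aa'] := entry_gt0 a HTk.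
have [w [zw a'w]] := scr z a'.
exists k.+1, w => y; rewrite inE exprSr => /predU1P[->|/kz yz].
  exact: entry_mul_gt0 aa' a'w.
exact: entry_mul_gt0 yz zw.
Qed.

Lemma positive_column T m : (0 < #|X|)%N ->
  transition_matrix T -> ergodicity_coef (T ^+ m) < 1 ->
  exists n z, forall k, (n <= k)%N -> forall y, 0 < entry (T ^+ k) y z.
Proof.
move=> X0 HT erg.
have HTm := transition_matrixX m HT.
have scr x y := ergodicity_coef_lt1 x y HTm erg.
have [k [z kz]] := common_successor (enum X) X0 HTm scr.
exists (m * k)%N, z => l mkl y.
have [w yw] := entry_gt0 y (transition_matrixX (l - m * k) HT).
rewrite -(subnK mkl) exprD.
apply: entry_mul_gt0 yw _; try exact: transition_matrixX.
by rewrite exprM kz // mem_enum.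
Qed.

Lemma closed_entryX T A : transition_matrix T ->
  (forall x z, A x -> 0 < entry T x z -> A z) ->
  forall k x z, A x -> 0 < entry (T ^+ k) x z -> A z.
Proof.
move=> HT HA; elim=> [|k IH] x z Ax.
  by rewrite expr0 entry1; case: eqP => [<-|_]; rewrite ?ltxx.
rewrite exprS => /(entry_mul_gt0E HT (transition_matrixX k HT))[w xw].
by apply: IH; apply: HA xw.
Qed.

Lemma closed_disjoint_ergodicity_coef T A B m (x y : X) :
  transition_matrix T ->
  (forall x z, A x -> 0 < entry T x z -> A z) ->
  (forall x z, B x -> 0 < entry T x z -> B z) ->
  (forall z, A z -> ~ B z) -> A x -> B y -> ~ (ergodicity_coef (T ^+ m) < 1).
Proof.
move=> HT HA HB AB Ax By.
move=> /(ergodicity_coef_lt1 x y (transition_matrixX m HT))[z [xz yz]].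
exact: AB (closed_entryX HT HA Ax xz) (closed_entryX HT HB By yz).
Qed.

End TransitionMatrices.

(** * Upper and lower transition operators *)

Section TransitionOperators.
Context {R : realType} {X : finType} (Q : X -> set (X -> R)).
Hypothesis hQ : forall x : X, credal_set (Q x).
Implicit Types (h g : X -> R) (x y z : X).

Local Notation Tup := (upper_trans Q).
Local Notation Tlow := (lower_of (upper_trans Q)).

Lemma upper_trans_ge h x q : Q x q -> \sum_z h z * q z <= Tup h x.
Proof. by move=> Qq; apply: (upper_trans_max h (hQ x)).2; exists q. Qed.

Lemma upper_trans_attained h x : exists2 q, Q x q & Tup h x = \sum_z h z * q z.
Proof. by have [q Qq <-] := (upper_trans_max h (hQ x)).1; exists q. Qed.

Lemma credal_pmf x q : Q x q -> Defs.pmf q.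
Proof. by have [+ _ _ _] := hQ x; apply. Qed.

Lemma upper_trans_mono h g x : (forall y, h y <= g y) -> Tup h x <= Tup g x.
Proof.
move=> hg; have [q Qq ->] := upper_trans_attained h x.
apply: le_trans (upper_trans_ge g Qq).
by apply: ler_sum => z _; rewrite ler_wpM2r // (credal_pmf Qq).1.
Qed.

Lemma iter_upper_trans_mono k h g x :
  (forall y, h y <= g y) -> iter k Tup h x <= iter k Tup g x.
Proof.
elim: k x => [|k IH] x hg //=.
by apply: upper_trans_mono => y; apply: IH.
Qed.

Lemma upper_trans_scale (c : R) h x :
  c * Tup h x <= Tup (fun y => c * h y) x.
Proof.
have [q Qq ->] := upper_trans_attained h x.
apply: le_trans (upper_trans_ge _ Qq).
by rewrite mulr_sumr; apply: ler_sum => z _; rewrite mulrA.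
Qed.

Lemma iter_upper_trans_scale k (c : R) h x :
  c * iter k Tup h x <= iter k Tup (fun y => c * h y) x.
Proof.
elim: k x => [|k IH] x //=; apply: le_trans (upper_trans_scale _ _ _) _.
exact: upper_trans_mono.
Qed.

Lemma iter_upper_trans_ge T k h x : transition_matrices Tup T ->
  \sum_z h z * entry (T ^+ k) x z <= iter k Tup h x.
Proof.
move=> HT; elim: k x => [|k IH] x.
  rewrite expr0 (bigD1 x) //= entry1 eqxx mulr1 big1 ?addr0 // => z zx.
  by rewrite entry1 eq_sym (negbTE zx) mulr0.
apply: le_trans ((HT x).2 (iter k Tup h)).
under eq_bigr => z _ do rewrite exprS entry_mul mulr_sumr.
rewrite exchange_big /=; apply: ler_sum => w _.
apply: (@le_trans _ _ ((\sum_z h z * entry (T ^+ k) w z) * entry T x w)).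
  by rewrite mulr_suml; apply: ler_sum => z _; rewrite mulrCA mulrC.
by rewrite ler_wpM2r // (HT x).1.1.
Qed.

Lemma lower_trans_attained h x : exists2 q, Q x q & Tlow h x = \sum_z h z * q z.
Proof.
have [q Qq Eq] := upper_trans_attained (fun y => - h y) x.
exists q => //; rewrite /lower_of Eq -sumrN.
by apply: eq_bigr => z _; rewrite mulNr opprK.
Qed.

Lemma lower_trans_mono h g x : (forall y, h y <= g y) -> Tlow h x <= Tlow g x.
Proof.
by move=> hg; rewrite lerN2; apply: upper_trans_mono => y; rewrite lerN2.
Qed.

(** A matrix of the chain is obtained by choosing its rows independently. *)
Lemma transition_matrices_rows (q : X -> X -> R) : (forall x, Q x (q x)) ->
  exists2 T, transition_matrices Tup T & forall x z, entry T x z = q x z.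
Proof.
move=> Qq; pose T : 'M[R]_#|X| := \matrix_(i, j) q (enum_val i) (enum_val j).
have TE x z : entry T x z = q x z by rewrite /entry mxE !enum_rankK.
exists T => // x; have -> : entry T x = q x by apply/funext => z.
by split=> [|h]; [apply: credal_pmf (Qq x) | apply: upper_trans_ge].
Qed.

(** A one-step transition of positive probability [q y] from a regular state
    [x] leads to a regular state [y], as [Tup \1_[set y] >= q y * \1_[set x]]. *)
Lemma regular_states_closed x y q :
  regular_states Tup x -> Q x q -> 0 < q y -> regular_states Tup y.
Proof.
move=> [n [n0 regx]] Qq qy; exists n.+1; split=> // -[//|k] nk z.
rewrite iterSr.
apply: (@lt_le_trans _ _ (q y * iter k Tup \1_[set x] z)).
  by rewrite mulr_gt0 // regx.
apply: le_trans (iter_upper_trans_scale _ _ _ _) _.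
apply: iter_upper_trans_mono => w.
have ge0 u r : Q u r -> 0 <= \sum_v \1_[set y] v * r v.
  move=> Qr; apply: sumr_ge0 => v _.
  by rewrite indicE mulr_ge0 ?ler0n // (credal_pmf Qr).1.
have [->|wx] := eqVneq w x; last first.
(* Off [x] the lower bound [q y * \1_[set x]] vanishes. *)
  rewrite indic_set1 (negbTE wx) mulr0.
  by have [r Qr ->] := upper_trans_attained \1_[set y] w; apply: ge0 Qr.
apply: le_trans (upper_trans_ge _ Qq).
rewrite (bigD1 y) //= !indic_set1 !eqxx mulr1 mul1r lerDl.
by apply: sumr_ge0 => v _; rewrite indicE mulr_ge0 ?ler0n // (credal_pmf Qq).1.
Qed.

(** Closedness of the set of regular states makes its indicator a
    subsolution of the lower operator, whose iterates therefore increase. *)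
Lemma iter_lower_regular_nondecreasing n m x : (n <= m)%N ->
  iter n Tlow \1_(regular_states Tup) x <=
  iter m Tlow \1_(regular_states Tup) x.
Proof.
move=> /subnK <-; elim: (m - n)%N => [//|k IH]; apply: le_trans IH _.
rewrite addSn; elim: (k + n)%N x => [|l IH] x /=; last exact: lower_trans_mono.
have [q Qq ->] := lower_trans_attained \1_(regular_states Tup) x.
have [q0 q1] := credal_pmf Qq.
have [Rx|Rx] := pselect (regular_states Tup x); last first.
  rewrite indicE memNset //; apply: sumr_ge0 => z _.
  by rewrite mulr_ge0 // indicE ler0n.
rewrite indicE mem_set // -q1; apply: ler_sum => z _.
have [qz|qz] := ltP 0 (q z).
  by rewrite indicE mem_set ?mul1r //; apply: regular_states_closed Rx Qq qz.
by apply: le_trans qz _; rewrite mulr_ge0 // indicE ler0n.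
Qed.

Lemma iter_lower_regular_ge0 n x : 0 <= iter n Tlow \1_(regular_states Tup) x.
Proof.
apply: le_trans (iter_lower_regular_nondecreasing x (leq0n n)).
by rewrite /= indicE ler0n.
Qed.

(** The states from which the chain can forever avoid being absorbed: all lower
    probabilities of sitting in a regular state are zero.  These probabilities
    being nonnegative, [<= 0] expresses this; [n = 0] excludes the regular
    states. *)
Definition avoiding_states : set X :=
  [set y | forall n, iter n Tlow \1_(regular_states Tup) y <= 0].

Lemma regular_not_avoiding z : regular_states Tup z -> ~ avoiding_states z.
Proof. by move=> Rz /(_ 0%N); rewrite /= indicE mem_set // ler10. Qed.

Lemma avoiding_states_invariant x : avoiding_states x ->
  exists2 q, Q x q & forall z, 0 < q z -> avoiding_states z.
Proof.
move=> Bx.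
have /choice[f Hf] : forall z, exists n,
    ~ avoiding_states z -> 0 < iter n Tlow \1_(regular_states Tup) z.
  move=> z; have [Bz|/existsNP[n /negP nz]] := pselect (avoiding_states z).
    by exists 0%N.
  by exists n; rewrite ltNge.
(* By monotonicity and finiteness a single exponent serves all states. *)
pose N := \max_z f z.
have posN z : ~ avoiding_states z -> 0 < iter N Tlow \1_(regular_states Tup) z.
  move=> /Hf /lt_le_trans; apply; apply: iter_lower_regular_nondecreasing.
  exact: leq_bigmax.
have [q Qq Eq] := lower_trans_attained (iter N Tlow \1_(regular_states Tup)) x.
exists q => // z qz; apply: contrapT => /posN Nz.
have := Bx N.+1; rewrite iterS Eq; apply/negP; rewrite -ltNge.
rewrite (bigD1 z) //= ltr_pwDl ?mulr_gt0 // sumr_ge0 // => w _.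
by rewrite mulr_ge0 ?iter_lower_regular_ge0 // (credal_pmf Qq).1.
Qed.

Lemma product_scrambling_regular : (0 < #|X|)%N ->
  product_scrambling (transition_matrices Tup) -> regular_states Tup !=set0.
Proof.
move=> X0 [m [_ scr]].
have /choice[q Qq] : forall x, exists q, Q x q by move=> x; case: (hQ x).
have [T TT _] := transition_matrices_rows Qq.
have HT := transition_matrices_sub TT.
have [|n [z nz]] := positive_column (m := m) X0 HT.
  by apply: scr; exists (fun=> T); split=> //; rewrite prodr_const card_ord.
exists z, n.+1; split=> // k nk y.
apply: lt_le_trans (iter_upper_trans_ge k _ y TT).
rewrite (bigD1 z) //= indic_set1 eqxx mul1r ltr_pwDl ?nz 1?ltnW //.
apply: sumr_ge0 => w _; rewrite mulr_ge0 ?indicE ?ler0n //.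
exact: (transition_matrixX k HT).1.
Qed.

Lemma product_scrambling_not_avoiding y :
  product_scrambling (transition_matrices Tup) -> regular_states Tup !=set0 ->
  ~ avoiding_states y.
Proof.
move=> [m [_ scr]] [x Rx] By.
have /choice[q Qq] : forall u, exists q, Q u q /\
    (avoiding_states u -> forall z, 0 < q z -> avoiding_states z).
  move=> u; have [/avoiding_states_invariant[q ? ?]|Bu] :=
    pselect (avoiding_states u); first by exists q.
  by have [_ [q Qq] _ _] := hQ u; exists q.
have [T TT TE] := transition_matrices_rows (fun u => (Qq u).1).
apply: (closed_disjoint_ergodicity_coef (m := m) (transition_matrices_sub TT)
  _ _ regular_not_avoiding Rx By).
- by move=> u z Ru; rewrite TE; apply: regular_states_closed Ru (Qq u).1.
- by move=> u z Bu; rewrite TE; apply: (Qq u).2.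
- by apply: scr; exists (fun=> T); split=> //; rewrite prodr_const card_ord.
Qed.

End TransitionOperators.

Theorem proposition5p3 (R : realType) (X : finType) (hX : (0 < #|X|)%N)
    (Q : X -> set (X -> R)) (hQ : forall x : X, credal_set (Q x)) :
  product_scrambling (transition_matrices (upper_trans Q)) ->
  regularly_absorbing (upper_trans Q).
Proof.
move=> scr; have R0 := product_scrambling_regular hQ hX scr.
split=> // y Ry.
have /existsNP[n /negP] := product_scrambling_not_avoiding hQ (y := y) scr R0.
rewrite -ltNge => ny; exists n.+1; split=> //; apply: lt_le_trans ny _.
exact: (iter_lower_regular_nondecreasing hQ y (leqnSn n)).
Qed.
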